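(* Let $(\mathscr{K},\otimes,1)$ be a tensor triangulated category. Suppose that $U(\mathscr{S})=\operatorname{Spc}(\mathscr{K})$ for some collection of objects $\mathscr{S}\subset\mathscr{K}$. Then there exist $b_1,\ldots,b_n\in\mathscr{S}$ such that $b_1\otimes\cdots\otimes b_n=0$. In particular, the spectrum $\operatorname{Spc}(\mathscr{K})$ is quasi-compact.
   Context: All categories are essentially small. A tensor triangulated category $(\mathscr{K},\otimes,1)$ is a triangulated category $\mathscr{K}$ (translation functor $T$) with a symmetric monoidal product $\otimes:\mathscr{K}\times\mathscr{K}\to\mathscr{K}$ which is exact in each variable, with unit $1$. A thick $\otimes$-ideal of $\mathscr{K}$ is a full subcategory $\mathscr{A}$ containing $0$ such that: (a) for any distinguished triangle $a\to b\to c\to Ta$, if two of $a,b,c$ belong to $\mathscr{A}$ then so does the third; (b) if $a\in\mathscr{A}$ and $a\simeq b\oplus c$ in $\mathscr{K}$ then $b,c\in\mathscr{A}$; (c) if $a\in\mathscr{A}$ and $b\in\mathscr{K}$ then $a\otimes b\in\mathscr{A}$. A prime of $\mathscr{K}$ is a thick $\otimes$-ideal $\mathscr{P}\subsetneq\mathscr{K}$ such that $a\otimes b\in\mathscr{P}$ implies $a\in\mathscr{P}$ or $b\in\mathscr{P}$. $\operatorname{Spc}(\mathscr{K})$ is the set of all primes of $\mathscr{K}$, with the Zariski topology, whose closed subsets are the sets $Z(\mathscr{S})=\{\mathscr{P}\in\operatorname{Spc}(\mathscr{K})\mid\mathscr{S}\cap\mathscr{P}=\varnothing\}$ for collections of objects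 $\mathscr{S}\subset\mathscr{K}$. $U(\mathscr{S})=\operatorname{Spc}(\mathscr{K})\smallsetminus Z(\mathscr{S})=\{\mathscr{P}\mid\mathscr{S}\cap\mathscr{P}\neq\varnothing\}$. The finite family $b_1,\dots,b_n$ may be empty ($n=0$), the empty tensor product being $1$; ''$=0$'' means being a zero object. *)

(* Defs.v *)
From HB Require Import structures.
From mathcomp Require Import all_boot all_algebra.
From mathcomp Require Import boolp classical_sets topology.

Set Implicit Arguments.
Unset Strict Implicit.
Unset Printing Implicit Defensive.

Import GRing.Theory.

Declare Scope cat_scope.
Delimit Scope cat_scope with cat.
Local Open Scope classical_set_scope.
Local Open Scope ring_scope.
Local Open Scope cat_scope.

Reserved Notation "g ∘ f" (at level 40, left associativity).
Reserved Notation "a ⊕ b" (at level 50, left associativity).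
Reserved Notation "a ⊗ b" (at level 40, left associativity).
Reserved Notation "f ⊗m g" (at level 40, left associativity).

(* The collection of objects is a type, so categories are small; composition
   is written in the usual order. *)
HB.mixin Record isPreadditive (K : Type) := {
  hom : K -> K -> zmodType;
  idm : forall a : K, hom a a;
  compm : forall a b c : K, hom b c -> hom a b -> hom a c;
  compmA : forall (a b c d : K) (h : hom c d) (g : hom b c) (f : hom a b),
    compm a c d h (compm a b c g f) = compm a b d (compm b c d h g) f;
  comp1m : forall (a b : K) (f : hom a b), compm a b b (idm b) f = f;
  compm1 : forall (a b : K) (f : hom a b), compm a a b f (idm a) = f;
  compmDl : forall (a b c : K) (g g' : hom b c) (f : hom a b),
    compm a b c (g + g') f = compm a b c g f + compm a b c g' f;
  compmDr : forall (a b c : K) (g : hom b c) (f f' : hom a b),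
    compm a b c g (f + f') = compm a b c g f + compm a b c g f'
}.

#[short(type="preadditiveType")]
HB.structure Definition Preadditive := {K of isPreadditive K}.

Arguments idm {K} a : rename.
Arguments compm {K a b c} g f : rename.
Arguments compmA {K a b c d} h g f : rename.
Arguments comp1m {K a b} f : rename.
Arguments compm1 {K a b} f : rename.
Arguments compmDl {K a b c} g g' f : rename.
Arguments compmDr {K a b c} g f f' : rename.
Notation "g ∘ f" := (compm g f) : cat_scope.

Definition is_iso (K : preadditiveType) (a b : K) (f : hom a b) : Prop :=
  exists g : hom b a, g ∘ f = idm a /\ f ∘ g = idm b.

Definition isomorphic (K : preadditiveType) (a b : K) : Prop :=
  exists f : hom a b, is_iso f.

Definition is_zero (K : preadditiveType) (a : K) : Prop :=
  (forall b, exists! f : hom a b, True) /\ (forall b, exists! f : hom b a, True).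

Record functor (C D : preadditiveType) := Functor {
  fob :> C -> D;
  fhom : forall a b : C, hom a b -> hom (fob a) (fob b);
  fhom1 : forall a : C, fhom (idm a) = idm (fob a);
  fhomM : forall (a b c : C) (g : hom b c) (f : hom a b),
    fhom (g ∘ f) = fhom g ∘ fhom f
}.
Arguments fhom {C D} F {a b} f : rename.

Definition functor_id (C : preadditiveType) : functor C C :=
  @Functor C C id (fun _ _ f => f) (fun=> erefl) (fun _ _ _ _ _ => erefl).

Section FunctorComp.
Variables (C D E : preadditiveType) (G : functor D E) (F : functor C D).

Fact functor_comp1 (a : C) : fhom G (fhom F (idm a)) = idm (G (F a)).
Proof. by rewrite !fhom1. Qed.

Fact functor_compM (a b c : C) (g : hom b c) (f : hom a b) :
  fhom G (fhom F (g ∘ f)) = fhom G (fhom F g) ∘ fhom G (fhom F f).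
Proof. by rewrite !fhomM. Qed.

Definition functor_comp : functor C E :=
  @Functor C E (fun a => G (F a)) (fun _ _ f => fhom G (fhom F f))
    functor_comp1 functor_compM.
End FunctorComp.

Definition is_nat_iso (C D : preadditiveType) (F G : functor C D)
    (phi : forall a : C, hom (F a) (G a)) : Prop :=
  (forall (a b : C) (f : hom a b), fhom G f ∘ phi a = phi b ∘ fhom F f) /\
  (forall a : C, is_iso (phi a)).

Definition additive_functor (C D : preadditiveType) (F : functor C D) : Prop :=
  forall (a b : C) (f g : hom a b), fhom F (f + g) = fhom F f + fhom F g.

Definition is_equivalence (C D : preadditiveType) (F : functor C D) : Prop :=
  exists G : functor D C,
    (exists eta, @is_nat_iso C C (functor_id C) (functor_comp G F) eta) /\
    (exists eps, @is_nat_iso D D (functor_comp F G) (functor_id D) eps).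

HB.mixin Record isAdditive K of Preadditive K := {
  zob : K;
  zobP : is_zero zob;
  biprod : K -> K -> K;
  inj1 : forall a b : K, hom a (biprod a b);
  inj2 : forall a b : K, hom b (biprod a b);
  proj1 : forall a b : K, hom (biprod a b) a;
  proj2 : forall a b : K, hom (biprod a b) b;
  proj1_inj1 : forall a b : K, proj1 a b ∘ inj1 a b = idm a;
  proj2_inj2 : forall a b : K, proj2 a b ∘ inj2 a b = idm b;
  proj1_inj2 : forall a b : K, proj1 a b ∘ inj2 a b = 0;
  proj2_inj1 : forall a b : K, proj2 a b ∘ inj1 a b = 0;
  inj_proj : forall a b : K,
    inj1 a b ∘ proj1 a b + inj2 a b ∘ proj2 a b = idm (biprod a b)
}.

#[short(type="additiveType")]
HB.structure Definition Additive := {K of isAdditive K & Preadditive K}.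

Arguments zob {K} : rename.
Notation "a ⊕ b" := (biprod a b) : cat_scope.

(* The axioms are Verdier's; the translation functor is only required to be
   an equivalence, which includes the case of an automorphism. *)
HB.mixin Record isTriangulated K of Additive K := {
  shift : functor K K;
  shift_additive : additive_functor shift;
  shift_equivalence : is_equivalence shift;
  dist : forall a b c : K, hom a b -> hom b c -> hom c (shift a) -> Prop;
  dist_iso : forall (a b c a' b' c' : K)
      (f : hom a b) (g : hom b c) (h : hom c (shift a))
      (f' : hom a' b') (g' : hom b' c') (h' : hom c' (shift a'))
      (u : hom a a') (v : hom b b') (w : hom c c'),
    is_iso u -> is_iso v -> is_iso w ->
    v ∘ f = f' ∘ u -> w ∘ g = g' ∘ v -> fhom shift u ∘ h = h' ∘ w ->
    dist a b c f g h -> dist a' b' c' f' g' h';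
  dist_id : forall a : K, dist a a zob (idm a) 0 0;
  dist_cone : forall (a b : K) (f : hom a b),
    exists (c : K) (g : hom b c) (h : hom c (shift a)), dist a b c f g h;
  dist_rot : forall (a b c : K)
      (f : hom a b) (g : hom b c) (h : hom c (shift a)),
    dist a b c f g h <-> dist b c (shift a) g h (- fhom shift f);
  dist_morph : forall (a b c a' b' c' : K)
      (f : hom a b) (g : hom b c) (h : hom c (shift a))
      (f' : hom a' b') (g' : hom b' c') (h' : hom c' (shift a'))
      (u : hom a a') (v : hom b b'),
    dist a b c f g h -> dist a' b' c' f' g' h' -> v ∘ f = f' ∘ u ->
    exists w : hom c c', w ∘ g = g' ∘ v /\ fhom shift u ∘ h = h' ∘ w;
  dist_oct : forall (a b c x y z : K) (f : hom a b) (g : hom b c)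
      (i : hom b x) (j : hom x (shift a))
      (k : hom c y) (l : hom y (shift b))
      (m : hom c z) (n : hom z (shift a)),
    dist a b x f i j -> dist b c y g k l -> dist a c z (g ∘ f) m n ->
    exists (u : hom x z) (v : hom z y),
      [/\ dist x z y u v (fhom shift i ∘ l),
          u ∘ i = m ∘ g, n ∘ u = j, v ∘ m = k & l ∘ v = fhom shift f ∘ n]
}.

#[short(type="triangulatedType")]
HB.structure Definition Triangulated := {K of isTriangulated K & Additive K}.

Arguments shift {K} : rename.
Arguments dist {K a b c} f g h : rename.
Arguments dist_rot {K a b c} f g h : rename.
Arguments dist_cone {K a b} f : rename.
Arguments dist_morph {K a b c a' b' c' f g h f' g' h' u v} : rename.

Definition is_exact (C D : triangulatedType) (F : functor C D) : Prop :=
  additive_functor F /\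
  exists phi : forall a : C, hom (F (shift a)) (shift (F a)),
    @is_nat_iso C D (functor_comp F shift) (functor_comp shift F) phi /\
    forall (a b c : C) (f : hom a b) (g : hom b c) (h : hom c (shift a)),
      dist f g h -> dist (fhom F f) (fhom F g) (phi a ∘ fhom F h).

HB.mixin Record isSymMonoidal K of Preadditive K := {
  tunit : K;
  tensor : K -> K -> K;
  tensorm : forall a a' b b' : K,
    hom a a' -> hom b b' -> hom (tensor a b) (tensor a' b');
  tensorm1 : forall a b : K,
    tensorm a a b b (idm a) (idm b) = idm (tensor a b);
  tensormM : forall (a a' a'' b b' b'' : K) (f' : hom a' a'') (f : hom a a')
      (g' : hom b' b'') (g : hom b b'),
    tensorm a a'' b b'' (f' ∘ f) (g' ∘ g) =
    tensorm a' a'' b' b'' f' g' ∘ tensorm a a' b b' f g;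
  assoc : forall a b c : K, hom (tensor (tensor a b) c) (tensor a (tensor b c));
  lunit : forall a : K, hom (tensor tunit a) a;
  runit : forall a : K, hom (tensor a tunit) a;
  braid : forall a b : K, hom (tensor a b) (tensor b a);
  assoc_iso : forall a b c : K, is_iso (assoc a b c);
  lunit_iso : forall a : K, is_iso (lunit a);
  runit_iso : forall a : K, is_iso (runit a);
  assoc_nat : forall (a a' b b' c c' : K)
      (f : hom a a') (g : hom b b') (h : hom c c'),
    tensorm a a' (tensor b c) (tensor b' c') f (tensorm b b' c c' g h)
      ∘ assoc a b c =
    assoc a' b' c'
      ∘ tensorm (tensor a b) (tensor a' b') c c' (tensorm a a' b b' f g) h;
  lunit_nat : forall (a b : K) (f : hom a b),
    f ∘ lunit a = lunit b ∘ tensorm tunit tunit a b (idm tunit) f;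
  runit_nat : forall (a b : K) (f : hom a b),
    f ∘ runit a = runit b ∘ tensorm a b tunit tunit f (idm tunit);
  braid_nat : forall (a a' b b' : K) (f : hom a a') (g : hom b b'),
    tensorm b b' a a' g f ∘ braid a b = braid a' b' ∘ tensorm a a' b b' f g;
  braid_sym : forall a b : K, braid b a ∘ braid a b = idm (tensor a b);
  pentagon : forall a b c d : K,
    assoc a b (tensor c d) ∘ assoc (tensor a b) c d =
    tensorm a a (tensor (tensor b c) d) (tensor b (tensor c d))
        (idm a) (assoc b c d)
      ∘ (assoc a (tensor b c) d
      ∘ tensorm (tensor (tensor a b) c) (tensor a (tensor b c)) d d
          (assoc a b c) (idm d));
  triangle : forall a b : K,
    tensorm a a (tensor tunit b) b (idm a) (lunit b) ∘ assoc a tunit b =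
    tensorm (tensor a tunit) a b b (runit a) (idm b);
  hexagon : forall a b c : K,
    tensorm b b (tensor a c) (tensor c a) (idm b) (braid a c)
      ∘ (assoc b a c
      ∘ tensorm (tensor a b) (tensor b a) c c (braid a b) (idm c)) =
    assoc b c a ∘ (braid a (tensor b c) ∘ assoc a b c)
}.

#[short(type="symMonoidalType")]
HB.structure Definition SymMonoidal := {K of isSymMonoidal K & Preadditive K}.

Arguments tunit {K} : rename.
Arguments tensorm {K a a' b b'} f g : rename.
Notation "a ⊗ b" := (tensor a b) : cat_scope.
Notation "f ⊗m g" := (tensorm f g) : cat_scope.

Section TensorFunctors.
Variables (K : symMonoidalType) (a : K).

Fact tensorl_comp (b c d : K) (g : hom c d) (f : hom b c) :
  idm a ⊗m (g ∘ f) = (idm a ⊗m g) ∘ (idm a ⊗m f).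
Proof. by rewrite -tensormM comp1m. Qed.

Fact tensorr_comp (b c d : K) (g : hom c d) (f : hom b c) :
  (g ∘ f) ⊗m idm a = (g ⊗m idm a) ∘ (f ⊗m idm a).
Proof. by rewrite -tensormM comp1m. Qed.

Definition tensorl : functor K K :=
  @Functor K K (fun b => a ⊗ b) (fun b c f => idm a ⊗m f)
    (fun b => tensorm1 a b) tensorl_comp.

Definition tensorr : functor K K :=
  @Functor K K (fun b => b ⊗ a) (fun b c f => f ⊗m idm a)
    (fun b => tensorm1 b a) tensorr_comp.
End TensorFunctors.

HB.mixin Record isTensorTriangulated K of Triangulated K & SymMonoidal K := {
  tensorl_exact : forall a : K, is_exact (tensorl a);
  tensorr_exact : forall a : K, is_exact (tensorr a)
}.

#[short(type="tensorTriangulatedType")]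
HB.structure Definition TensorTriangulated :=
  {K of isTensorTriangulated K & Triangulated K & SymMonoidal K}.

(* A full subcategory is given by its set of objects. *)
Record thick_ideal (K : tensorTriangulatedType) (A : set K) : Prop := {
  thick0 : A zob;
  thick_tri3 : forall (a b c : K)
      (f : hom a b) (g : hom b c) (h : hom c (shift a)),
    dist f g h -> A a -> A b -> A c;
  thick_tri2 : forall (a b c : K)
      (f : hom a b) (g : hom b c) (h : hom c (shift a)),
    dist f g h -> A a -> A c -> A b;
  thick_tri1 : forall (a b c : K)
      (f : hom a b) (g : hom b c) (h : hom c (shift a)),
    dist f g h -> A b -> A c -> A a;
  thick_summand : forall a b c : K, A a -> isomorphic a (b ⊕ c) -> A b /\ A c;
  thick_tensor : forall a b : K, A a -> A (a ⊗ b)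
}.

Record prime_ideal (K : tensorTriangulatedType) (P : set K) : Prop := {
  prime_thick : thick_ideal P;
  prime_proper : P `<` [set: K];
  prime_tensor : forall a b : K, P (a ⊗ b) -> P a \/ P b
}.

Record Spc (K : tensorTriangulatedType) := {
  spc_set :> set K;
  spc_prime : prime_ideal spc_set
}.

HB.instance Definition _ (K : tensorTriangulatedType) := gen_eqMixin (Spc K).
HB.instance Definition _ (K : tensorTriangulatedType) :=
  gen_choiceMixin (Spc K).

Definition Zset (K : tensorTriangulatedType) (S : set K) : set (Spc K) :=
  [set P : Spc K | S `&` P = set0].

Definition Uset (K : tensorTriangulatedType) (S : set K) : set (Spc K) :=
  ~` Zset S.

(* The facts up to [thick_biprod] are used to show that the sets [Uset S] are
   closed under binary intersections. *)
Section PreadditiveFacts.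
Variable K : preadditiveType.

Lemma comp0m (a b c : K) (f : hom a b) : (0 : hom b c) ∘ f = 0.
Proof. by apply: (addrI (0 ∘ f)); rewrite -compmDl !addr0. Qed.

Lemma compm0 (a b c : K) (f : hom b c) : f ∘ (0 : hom a b) = 0.
Proof. by apply: (addrI (f ∘ 0)); rewrite -compmDr !addr0. Qed.

Lemma compNm (a b c : K) (g : hom b c) (f : hom a b) : (- g) ∘ f = - (g ∘ f).
Proof. by apply: (addrI (g ∘ f)); rewrite -compmDl !addrN comp0m. Qed.

Lemma compmN (a b c : K) (g : hom b c) (f : hom a b) : g ∘ (- f) = - (g ∘ f).
Proof. by apply: (addrI (g ∘ f)); rewrite -compmDr !addrN compm0. Qed.

Lemma is_zero_to (a b : K) (f g : hom b a) : is_zero a -> f = g.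
Proof. by move=> [_ /(_ b)[h [_ hP]]]; rewrite -(hP f) // -(hP g). Qed.

Lemma is_zero_from (a b : K) (f g : hom a b) : is_zero a -> f = g.
Proof. by move=> [/(_ b)[h [_ hP]] _]; rewrite -(hP f) // -(hP g). Qed.

Lemma iso_mono (a b c : K) (f : hom b c) (g h : hom a b) :
  is_iso f -> f ∘ g = f ∘ h -> g = h.
Proof.
by move=> [f' [f'f _]] e; rewrite -(comp1m g) -(comp1m h) -f'f -!compmA e.
Qed.

Lemma iso_epi (a b c : K) (f : hom a b) (g h : hom b c) :
  is_iso f -> g ∘ f = h ∘ f -> g = h.
Proof.
by move=> [f' [_ ff']] e; rewrite -(compm1 g) -(compm1 h) -ff' !compmA e.
Qed.

End PreadditiveFacts.

Lemma equivalence_faithful (C D : preadditiveType) (F : functor C D) :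
  is_equivalence F ->
  forall (a b : C) (f g : hom a b), fhom F f = fhom F g -> f = g.
Proof.
move=> [G [[eta [etaN etaI]] _]] a b f g e.
apply: (iso_mono (etaI b)).
by rewrite -[LHS](etaN _ _ f) -[RHS](etaN _ _ g) /= e.
Qed.

Lemma equivalence_full (C D : preadditiveType) (F : functor C D) :
  is_equivalence F ->
  forall (a b : C) (w : hom (F a) (F b)), exists v : hom a b, fhom F v = w.
Proof.
move=> [G [[eta [etaN etaI]] [eps [epsN epsI]]]] a b w.
have Gf (x y : D) (f g : hom x y) : fhom G f = fhom G g -> f = g.
  move=> e; apply: (iso_epi (epsI x)).
  by rewrite [LHS](epsN _ _ f) [RHS](epsN _ _ g) /= e.
have [etab [_ etabK]] := etaI b.
exists (etab ∘ (fhom G w ∘ eta a)); apply: Gf.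
apply: (iso_epi (etaI a)).
by rewrite [LHS](etaN _ _ _) /= compmA etabK comp1m.
Qed.

Section TriangulatedFacts.
Variable K : triangulatedType.

Lemma dist_comp (a b c : K) (f : hom a b) (g : hom b c) (h : hom c (shift a)) :
  dist f g h -> g ∘ f = 0.
Proof.
move=> d.
have [w [e _]] := dist_morph (u := idm a) (v := f) (dist_id a) d erefl.
by rewrite -e compm0.
Qed.

Lemma dist_lift (x a b c : K)
    (f : hom a b) (g : hom b c) (h : hom c (shift a)) (u : hom x b) :
  dist f g h -> g ∘ u = 0 -> exists t : hom x a, f ∘ t = u.
Proof.
move=> d gu.
have d1 := (dist_rot _ _ _).1 ((dist_rot _ _ _).1 (dist_id x)).
have d2 := (dist_rot _ _ _).1 d; have d0 := (dist_rot _ _ _).1 (dist_id x).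
have e : (0 : hom (zob : K) c) ∘ 0 = g ∘ u by rewrite gu compm0.
have [w [_ +]] := dist_morph d0 d2 e.
rewrite fhom1 compmN compm1 compNm => /oppr_inj wE.
have [t tE] := equivalence_full (@shift_equivalence K) w.
exists t; apply: (equivalence_faithful (@shift_equivalence K)).
by rewrite fhomM tE.
Qed.

Lemma isomorphic_biprod0 (a b : K) : isomorphic a b -> isomorphic a (b ⊕ zob).
Proof.
move=> [f [g [gf fg]]]; exists (inj1 b zob ∘ f); exists (g ∘ proj1 b zob).
split.
  by rewrite -compmA (compmA (proj1 _ _)) proj1_inj1 comp1m.
rewrite -compmA (compmA f) fg comp1m -(inj_proj b zob).
rewrite (@is_zero_to K zob _ (proj2 b zob) 0); last exact: zobP.
by rewrite compm0 addr0.
Qed.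

Lemma cone_inj1 (a b c : K) (g : hom (a ⊕ b) c) (h : hom c (shift a)) :
  dist (inj1 a b) g h -> isomorphic b c.
Proof.
move=> d; have gi := dist_comp d.
have h0 : h = 0.
  have := dist_comp ((dist_rot _ _ _).1 ((dist_rot _ _ _).1 d)).
  rewrite compNm => /eqP; rewrite oppr_eq0 => /eqP Tih.
  rewrite -(comp1m h) -fhom1 -(proj1_inj1 a b) fhomM -compmA Tih.
  by rewrite compm0.
have [s gs] : exists s : hom c (a ⊕ b), g ∘ s = idm c.
  apply: (dist_lift (u := idm c) ((dist_rot _ _ _).1 d)).
  by rewrite h0 comp0m.
exists (g ∘ inj2 a b); exists (proj2 a b ∘ s); split.
  have [t tE] : exists t : hom b a,
      inj1 a b ∘ t = s ∘ (g ∘ inj2 a b) - inj2 a b.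
    by apply: (dist_lift d); rewrite compmDr compmN compmA gs comp1m addrN.
  have e : s ∘ (g ∘ inj2 a b) = inj1 a b ∘ t + inj2 a b by rewrite tE subrK.
  by rewrite -compmA e compmDr compmA proj2_inj1 comp0m add0r proj2_inj2.
have e : inj2 a b ∘ proj2 a b = idm _ - inj1 a b ∘ proj1 a b.
  by rewrite -(inj_proj a b) addrC addKr.
rewrite -compmA (compmA (inj2 a b)) e compmDl comp1m compNm compmDr compmN gs.
by rewrite !compmA gi !comp0m subr0.
Qed.

End TriangulatedFacts.

Lemma thick_biprod (K : tensorTriangulatedType) (A : set K) (a b : K) :
  thick_ideal A -> A (a ⊕ b) <-> A a /\ A b.
Proof.
move=> tA; split=> [Aab|[Aa Ab]].
  apply: (thick_summand tA Aab); exists (idm _); exists (idm _).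
  by rewrite comp1m.
have [c [g [h d]]] := dist_cone (inj1 a b).
have [f [f' [f'f ff']]] := cone_inj1 d.
apply: (thick_tri2 tA d Aa).
apply: (thick_summand tA Ab (b := c) (c := zob) _).1.
by apply: isomorphic_biprod0; exists f; exists f'.
Qed.

Section ZariskiTopology.
Variable K : tensorTriangulatedType.
Implicit Types (S : set K) (P : Spc K).

Lemma UsetP S P : Uset S P <-> exists a, S a /\ spc_set P a.
Proof.
rewrite /Uset /Zset /=; split=> [/eqP/set0P[a [Sa Pa]]|[a [Sa Pa]]].
  by exists a.
by apply/eqP/set0P; exists a.
Qed.

Let zopen (V : set (Spc K)) : Prop := exists S, V = Uset S.

Fact zopenT : zopen setT.
Proof.
exists [set zob]; apply/esym/seteqP; split=> // P _; apply/UsetP.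
by exists zob; split=> //; exact: thick0 (prime_thick (spc_prime P)).
Qed.

Fact zopenI : setI_closed zopen.
Proof.
move=> _ _ [S1 ->] [S2 ->].
exists [set c | exists a b, [/\ S1 a, S2 b & c = a ⊕ b]].
apply/seteqP; split=> P.
  move=> [/UsetP[a [Sa Pa]] /UsetP[b [Sb Pb]]]; apply/UsetP.
  exists (a ⊕ b); split; first by exists a, b.
  by apply/(thick_biprod _ _ (prime_thick (spc_prime P))).
move=> /UsetP[_ [[a [b [Sa Sb ->]]]]].
move=> /(thick_biprod _ _ (prime_thick (spc_prime P)))[Pa Pb].
by split; apply/UsetP; [exists a|exists b].
Qed.

Fact zopen_bigU (I : Type) (f : I -> set (Spc K)) :
  (forall i, zopen (f i)) -> zopen (\bigcup_i f i).
Proof.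
move=> fo; exists [set a | exists i S, f i = Uset S /\ S a].
apply/seteqP; split=> P.
  move=> [i _]; have [S fS] := fo i; rewrite fS => /UsetP[a [Sa Pa]].
  by apply/UsetP; exists a; split=> //; exists i, S.
move=> /UsetP[a [[i [S [fS Sa]]] Pa]].
by exists i => //; rewrite fS; apply/UsetP; exists a.
Qed.

HB.instance Definition _ :=
  isOpenTopological.Build (Spc K) zopenT zopenI zopen_bigU.

Lemma open_zariski (V : set (Spc K)) : open V <-> exists S, V = Uset S.
Proof. by []. Qed.

Lemma closed_zariski (V : set (Spc K)) : closed V <-> exists S, V = Zset S.
Proof.
rewrite -openC open_zariski; split=> -[S VS]; exists S.
  by rewrite -(setCK V) VS setCK.
by rewrite VS.
Qed.

End ZariskiTopology.

(* Main.v *)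
Require Import Defs.
From mathcomp Require Import all_boot ssralg finmap.
From mathcomp Require Import boolp classical_sets topology.

(** The statement generalises to tensor triangulated categories the fact that
    an element lying in every prime of a ring is nilpotent, and it has the same
    proof: primes are produced by maximality.

    Let M be a family of objects containing the unit and closed, up to
    isomorphism, under tensor products, and suppose that no object of M is
    zero. The thick tensor ideal of zero objects is then disjoint from M, so
    Zorn's lemma gives a thick tensor ideal P maximal among those disjoint from
    M, and such a P is prime ([exists_prime_avoiding]). Primality uses the
    colon ideals of objects x such that x ⊗ b lies in P: tensoring with b being
    an exact functor, these are again thick tensor ideals ([thick_colon]), and
    they contain P, so by maximality each of them either equals P or meets M.

    Take for M the finite tensor products of objects of S. If none of them were
    zero, there would be a prime disjoint from M, hence from S, and S would not
    have U(S) equal to the whole spectrum ([Uset_zero_product]).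

    For quasi-compactness, let S consist of the objects a such that the primes
    containing a all lie in one member of the given open cover. By the
    definition of the topology, U(S) is the whole spectrum, so some product of
    objects of S is zero. A prime contains this product, hence contains one of
    its factors, and the members of the cover attached to these finitely many
    factors form a finite subcover ([tensor_product_finite_cover]). *)

Set Implicit Arguments.
Unset Strict Implicit.
Unset Printing Implicit Defensive.

Import GRing.Theory.
Local Open Scope classical_set_scope.
Local Open Scope ring_scope.
Local Open Scope cat_scope.

(** * Isomorphisms, zero objects and additive functors *)

Section Preadditive.
Variable K : preadditiveType.
Implicit Types a b c : K.

Lemma is_zeroP a : is_zero a <-> idm a = 0.
Proof.
split=> [za|e]; first exact: is_zero_from.
split=> b; exists 0; split=> // f _.
  by rewrite -(compm1 f) e compm0.
by rewrite -(comp1m f) e comp0m.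
Qed.

Lemma isomorphic_sym a b : isomorphic a b -> isomorphic b a.
Proof. by move=> [f [g [gf fg]]]; exists g, f. Qed.

Lemma isomorphic_trans a b c :
  isomorphic a b -> isomorphic b c -> isomorphic a c.
Proof.
move=> [f [f' [f'f ff']]] [g [g' [g'g gg']]].
exists (g ∘ f), (f' ∘ g'); split.
  by rewrite -compmA (compmA g') g'g comp1m.
by rewrite -compmA (compmA f) ff' comp1m.
Qed.

End Preadditive.

Lemma functor_isomorphic (C D : preadditiveType) (F : functor C D) (a b : C) :
  isomorphic a b -> isomorphic (F a) (F b).
Proof.
move=> [f [g [gf fg]]]; exists (fhom F f), (fhom F g).
by rewrite -!fhomM gf fg !fhom1.
Qed.

Lemma additive_functor0 (C D : preadditiveType) (F : functor C D) (a b : C) :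
  additive_functor F -> fhom F (0 : hom a b) = 0.
Proof. by move=> aF; apply: (addrI (fhom F 0)); rewrite -aF !addr0. Qed.

(** A biproduct is characterised by equations between sums of composites of its
    structure maps, and an additive functor preserves such equations. *)
Lemma additive_functor_biprod (C D : additiveType) (F : functor C D) (a b : C) :
  additive_functor F -> isomorphic (F (a ⊕ b)) (F a ⊕ F b).
Proof.
move=> aF.
exists (inj1 _ _ ∘ fhom F (proj1 a b) + inj2 _ _ ∘ fhom F (proj2 a b)).
exists (fhom F (inj1 a b) ∘ proj1 _ _ + fhom F (inj2 a b) ∘ proj2 _ _).
split; rewrite compmDl !compmDr -!compmA.
- rewrite !(compmA (proj1 _ _)) !(compmA (proj2 _ _)).
  rewrite proj1_inj1 proj2_inj2 proj1_inj2 proj2_inj1 !comp0m !comp1m !compm0.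
  by rewrite addr0 add0r -!fhomM -aF inj_proj fhom1.
- rewrite !(compmA (fhom F (proj1 _ _))) !(compmA (fhom F (proj2 _ _))).
  rewrite -!fhomM proj1_inj1 proj2_inj2 proj1_inj2 proj2_inj1.
  rewrite !(additive_functor0 _ _ aF) !fhom1 !comp0m !comp1m !compm0.
  by rewrite addr0 add0r inj_proj.
Qed.

(** * Thick tensor ideals *)

Section ThickIdeals.
Variable K : tensorTriangulatedType.
Implicit Types (A : set K) (a b c x : K).

(** Thick ideals are replete because an object isomorphic to b is isomorphic to
    b ⊕ 0, of which b is a summand. *)
Lemma thick_isomorphic A a b : thick_ideal A -> isomorphic a b -> A a -> A b.
Proof.
by move=> tA ab Aa; case: (thick_summand tA Aa (isomorphic_biprod0 ab)).
Qed.

Lemma thick_zero A a : thick_ideal A -> is_zero a -> A a.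
Proof.
move=> tA /is_zeroP za; apply: thick_isomorphic (thick0 tA) => //.
by exists 0, 0; split; [rewrite comp0m; apply/esym/is_zeroP; exact: zobP|
  rewrite comp0m za].
Qed.

(** The identity of c is killed by the zero map to the shift of a, so it factors
    through b. *)
Lemma dist_zero3 a b c (f : hom a b) (g : hom b c) (h : hom c (shift a)) :
  dist f g h -> is_zero a -> is_zero b -> is_zero c.
Proof.
move=> d /is_zeroP za zb; apply/is_zeroP.
have hz : h ∘ idm c = 0.
  rewrite -(comp1m h) -fhom1 za (additive_functor0 _ _ (@shift_additive K)).
  by rewrite !comp0m.
have [t <-] := dist_lift ((dist_rot _ _ _).1 d) hz.
by rewrite (is_zero_from g 0 zb) comp0m.
Qed.

Lemma dist_zero2 a b c (f : hom a b) (g : hom b c) (h : hom c (shift a)) :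
  dist f g h -> is_zero a -> is_zero c -> is_zero b.
Proof.
move=> d za zc; apply/is_zeroP.
have [t <-] := dist_lift d (is_zero_to (g ∘ idm b) 0 zc).
by rewrite (is_zero_from f 0 za) comp0m.
Qed.

(** Rotating the triangle puts the shift of a in third position; the shift is
    faithful, so it detects zero objects. *)
Lemma dist_zero1 a b c (f : hom a b) (g : hom b c) (h : hom c (shift a)) :
  dist f g h -> is_zero b -> is_zero c -> is_zero a.
Proof.
move=> d zb zc; have /is_zeroP := dist_zero3 ((dist_rot _ _ _).1 d) zb zc.
rewrite -fhom1 -(additive_functor0 a a (@shift_additive K)) => e.
by apply/is_zeroP; exact: (equivalence_faithful (@shift_equivalence K)).
Qed.

(** The least thick tensor ideal, which is where the search for a prime
    starts. *)
Lemma thick_zero_ideal : thick_ideal (@is_zero K).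
Proof.
split.
- exact: zobP.
- by move=> a b c f g h; exact: dist_zero3.
- by move=> a b c f g h; exact: dist_zero2.
- by move=> a b c f g h; exact: dist_zero1.
- move=> a b c za [f [g [_ fg]]].
  have z : idm (b ⊕ c) = 0 by rewrite -fg (is_zero_from f 0 za) comp0m.
  split; apply/is_zeroP.
    by rewrite -(proj1_inj1 b c) -(compm1 (proj1 b c)) z compm0 comp0m.
  by rewrite -(proj2_inj2 b c) -(compm1 (proj2 b c)) z compm0 comp0m.
- move=> a b /is_zeroP za; apply/is_zeroP.
  rewrite -tensorm1 za.
  exact: (additive_functor0 (F := tensorr b) a a (tensorr_exact b).1).
Qed.

(** The preimage of a thick ideal under an exact functor is closed under
    triangles and summands; closure under tensoring by y comes from exchanging
    the factors y and b. *)
Lemma thick_colon A b : thick_ideal A -> thick_ideal [set x | A (x ⊗ b)].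
Proof.
move=> tA; have [aF [phi [_ dF]]] := tensorr_exact b.
split=> /=.
- exact: thick_tensor (thick0 tA).
- by move=> x y z f g h /dF /(thick_tri3 tA); exact.
- by move=> x y z f g h /dF /(thick_tri2 tA); exact.
- by move=> x y z f g h /dF /(thick_tri1 tA); exact.
- move=> x y z Ax xyz.
  have /(thick_isomorphic tA)/(_ Ax) := functor_isomorphic (tensorr b) xyz.
  move/(thick_isomorphic tA (additive_functor_biprod y z aF)).
  by move/(thick_biprod _ _ tA).
- move=> x y Ax; have xyb : isomorphic (x ⊗ y ⊗ b) (x ⊗ b ⊗ y).
    apply: (isomorphic_trans (b := x ⊗ (y ⊗ b))).
      by exists (assoc x y b); exact: assoc_iso.
    apply: (isomorphic_trans (b := x ⊗ (b ⊗ y))).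
      apply: (functor_isomorphic (tensorl x)).
      by exists (braid y b), (braid b y); rewrite !braid_sym.
    apply: isomorphic_sym.
    by exists (assoc x b y); exact: assoc_iso.
  apply: (thick_isomorphic tA (isomorphic_sym xyb)).
  exact: thick_tensor.
Qed.

(** Each closure condition has at most two hypotheses, and in a chain any two
    members of the union already lie in a common ideal. *)
Lemma thick_bigcup_chain (F : set (set K)) :
  F !=set0 -> (forall A, F A -> thick_ideal A) -> total_on F subset ->
  thick_ideal (\bigcup_(A in F) A).
Proof.
move=> [A0 FA0] tF chF.
have both a b : (\bigcup_(A in F) A) a -> (\bigcup_(A in F) A) b ->
    exists A, [/\ F A, A a & A b].
  move=> [A FA Aa] [B FB Bb]; have [AB|BA] := chF A B FA FB.
    by exists B; split=> //; exact: AB.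
  by exists A; split=> //; exact: BA.
split.
- by exists A0 => //; exact: thick0 (tF _ FA0).
- move=> a b c f g h d Ua Ub; have [A [FA Aa Ab]] := both a b Ua Ub.
  by exists A => //; exact: (thick_tri3 (tF A FA) d Aa Ab).
- move=> a b c f g h d Ua Uc; have [A [FA Aa Ac]] := both a c Ua Uc.
  by exists A => //; exact: (thick_tri2 (tF A FA) d Aa Ac).
- move=> a b c f g h d Ub Uc; have [A [FA Ab Ac]] := both b c Ub Uc.
  by exists A => //; exact: (thick_tri1 (tF A FA) d Ab Ac).
- move=> a b c [A FA Aa] /(thick_summand (tF A FA) Aa)[Ab Ac].
  by split; exists A.
- by move=> a b [A FA Aa]; exists A => //; exact: (thick_tensor (tF A FA) b Aa).
Qed.

End ThickIdeals.

(** * Primes avoiding a multiplicative family *)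

Section MultiplicativeFamilies.
Variable K : tensorTriangulatedType.
Implicit Types (M A : set K) (a b s x y : K).

(** Closure under products is only asked up to isomorphism, since the product of
    two bracketed words is not itself a word bracketed to the right. *)
Definition tensor_multiplicative M : Prop :=
  M tunit /\ forall a b, M a -> M b -> exists2 c, M c & isomorphic (a ⊗ b) c.

(** An ideal P maximal among those disjoint from M is prime: if a ⊗ b lies in P
    but neither factor does, the colon ideal of b contains a, so it is larger
    than P and meets M in some s; then the colon ideal of s contains b, so it
    meets M in some t, and t ⊗ s lies both in P and, up to isomorphism, in
    M. *)
Lemma exists_prime_avoiding M :
  tensor_multiplicative M -> (forall a, M a -> ~ is_zero a) ->
  exists P : Spc K, forall a, M a -> ~ spc_set P a.
Proof.
move=> [M1 MM] Mnz.
pose avoids A := forall a, M a -> ~ A a.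
pose good A := thick_ideal A /\ avoids A.
(* The empty set is admitted only to serve as the union of the empty chain;
   as the ideal of zero objects is strictly larger, it is not maximal. *)
have [|P [[P0|[tP MP]] maxP]] := @Zorn_bigcup K [set A | A = set0 \/ good A].
- move=> F Fgood chF.
  have [[A0 [FA0 A0n]]|Fempty] := pselect (exists A, F A /\ A !=set0).
    (* Empty members do not change the union. *)
    have UE : \bigcup_(A in F) A = \bigcup_(A in F `&` [set A | A !=set0]) A.
      apply/seteqP; split=> a [A].
        by move=> FA Aa; exists A => //; split=> //; exists a.
      by move=> [FA _] Aa; exists A.
    have F'good A : (F `&` [set A | A !=set0]) A -> good A.
      by move=> [/Fgood /= [->|//] /= [a]].
    right; rewrite UE; split.
      apply: thick_bigcup_chain.
      + by exists A0.
      + by move=> A /F'good [].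
      + by move=> A B [FA _] [FB _]; exact: chF.
    by move=> a Ma [A /F'good [_]]; exact.
  left; apply/seteqP; split=> // a [A FA Aa].
  by apply: Fempty; exists A; split=> //; exists a.
- exfalso; apply: (maxP (@is_zero K)); last first.
    by right; split; [exact: thick_zero_ideal | exact: Mnz].
  rewrite P0; split=> // /(_ zob); apply; exact: zobP.
have meets A c : thick_ideal A -> P `<=` A -> A c -> ~ P c ->
    exists2 s, M s & A s.
  move=> tA PA Ac nPc; apply: contrapT => nMA; apply: (maxP A).
    by split=> // AP; apply/nPc/AP.
  by right; split=> // s Ms As; apply: nMA; exists s.
have pP : prime_ideal P.
  split=> //.
    split=> // /(_ tunit I); exact: MP.
  move=> a b Pab; apply: contrapT => /not_orP[nPa nPb].
  have [s Ms Psb] : exists2 s, M s & P (s ⊗ b).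
    apply: (meets [set x | P (x ⊗ b)] a) => //; first exact: thick_colon.
    by move=> x Px; exact: thick_tensor.
  have braid_in x y : P (x ⊗ y) -> P (y ⊗ x).
    apply: thick_isomorphic => //.
    by exists (braid x y), (braid y x); rewrite !braid_sym.
  have [t Mt Pts] : exists2 t, M t & P (t ⊗ s).
    apply: (meets [set x | P (x ⊗ s)] b) => //; first exact: thick_colon.
      by move=> x Px; exact: thick_tensor.
    exact: braid_in.
  have [c Mc tsc] := MM t s Mt Ms.
  exact: (MP c Mc (thick_isomorphic tP tsc Pts)).
by exists (Build_Spc pP).
Qed.

End MultiplicativeFamilies.

(** * Finite tensor products and covers of the spectrum *)

Section TensorProducts.
Variable K : tensorTriangulatedType.
Implicit Types (S : set K) (a x y : K).

(** Words are bracketed to the right and end with the unit, which is the shape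
    of the iterated products of [bigop]; an inductive predicate lets statements
    on such products be proved by adding one factor at a time. *)
Inductive tensor_product S : K -> Prop :=
| tensor_product_nil : tensor_product S tunit
| tensor_product_cons a x :
    S a -> tensor_product S x -> tensor_product S (a ⊗ x).

Lemma tensor_product1 S a : S a -> tensor_product S (a ⊗ tunit).
Proof. by move=> Sa; apply: tensor_product_cons => //; constructor. Qed.

Lemma tensor_product_multiplicative S : tensor_multiplicative (tensor_product S).
Proof.
split=> [|x y Sx Sy]; first by constructor.
elim: x / Sx => [|a x Sa _ [z Sz xyz]].
  by exists y => //; exists (lunit y); exact: lunit_iso.
exists (a ⊗ z); first by constructor.
apply: (isomorphic_trans (b := a ⊗ (x ⊗ y))).
  by exists (assoc a x y); exact: assoc_iso.
exact: (functor_isomorphic (tensorl a)).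
Qed.

Lemma tensor_product_big S x : tensor_product S x ->
  exists (n : nat) (b : 'I_n -> K),
    (forall i, S (b i)) /\ x = \big[@tensor K/@tunit K]_(i < n) b i.
Proof.
elim: x / => [|a x Sa _ [n [b [Sb xE]]]].
  by exists 0%N, (fun=> tunit); split=> [[]//|]; rewrite big_ord0.
exists n.+1, (fun i => oapp b a (unlift ord0 i)); split=> [i|].
  by case: unliftP => [j|] _ //=; exact: Sb.
rewrite big_ord_recl unlift_none /= xE; congr (a ⊗ _).
by apply: eq_bigr => i _; rewrite liftK.
Qed.

Lemma Uset_zero_product S : Uset S = [set: Spc K] ->
  exists2 x, tensor_product S x & is_zero x.
Proof.
move=> US; apply: contrapT => nz.
have [|P PS] := exists_prime_avoiding (tensor_product_multiplicative S).
  by move=> x Sx zx; apply: nz; exists x.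
have /UsetP[a [Sa Pa]] : Uset S P by rewrite US.
apply: (PS _ (tensor_product1 Sa)).
exact: (thick_tensor (prime_thick (spc_prime P)) _ Pa).
Qed.

(** An ideal containing the unit contains every object a, which is isomorphic to
    the product of the unit with a, whereas a prime is proper. *)
Lemma prime_tunit (P : Spc K) : ~ spc_set P tunit.
Proof.
move=> P1; have [tP [_ nP] _] := spc_prime P; apply: nP => a _.
apply: (thick_isomorphic tP (a := tunit ⊗ a)); last exact: thick_tensor.
by exists (lunit a); exact: lunit_iso.
Qed.

(** The primes containing a product are those containing one of the factors, and
    none contains the empty product; so one index per factor is enough. *)
Lemma tensor_product_finite_cover (I : choiceType) (D : set I)
    (f : I -> set (Spc K)) S x :
  (forall a, S a -> exists2 i, D i & [set P : Spc K | spc_set P a] `<=` f i) ->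
  tensor_product S x ->
  exists2 D' : {fset I}, {subset D' <= D} &
    [set P : Spc K | spc_set P x] `<=` cover [set` D'] f.
Proof.
move=> Sf Sx; elim: x / Sx => [|a x /Sf[i Di aI] _ [D' D'D xD']].
  by exists fset0 => // P /= /prime_tunit.
exists (i |` D')%fset => [j /fset1UP[->|/D'D //]|P /=]; first exact/mem_set.
move/(prime_tensor (spc_prime P)) => -[/aI fP|/xD' [j D'j fP]].
  by exists i => //=; exact: fset1U1.
by exists j => //=; exact: fset1Ur.
Qed.

Lemma Spc_cover_compact : cover_compact [set: Spc K].
Proof.
move=> J D f fopen fcover.
pose S := [set a : K | exists2 i, D i & [set P : Spc K | spc_set P a] `<=` f i].
have US : Uset S = [set: Spc K].
  apply/seteqP; split=> // P _; apply/UsetP; have [i Di] := fcover P Logic.I.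
  have [T fT] := (open_zariski (f i)).1 (fopen i Di).
  rewrite fT => /UsetP[a [Ta Pa]]; exists a; split=> //; exists i => //.
  by rewrite fT => Q Qa; apply/UsetP; exists a.
have [x Sx zx] := Uset_zero_product US.
have [//|D' D'D xD'] := tensor_product_finite_cover (D := D) (f := f) _ Sx.
exists D' => // P _; apply: xD' => /=.
exact: thick_zero (prime_thick (spc_prime P)) zx.
Qed.

End TensorProducts.

Theorem corollary2p15 (K : tensorTriangulatedType) :
  (forall S : set K, Uset S = [set: Spc K] ->
     exists (n : nat) (b : 'I_n -> K),
       (forall i, S (b i)) /\ is_zero (\big[@tensor K/@tunit K]_(i < n) b i)) /\
  cover_compact [set: Spc K].
Proof.
split=> [S US|]; last exact: Spc_cover_compact.
have [x /tensor_product_big[n [b [Sb ->]]] zb] := Uset_zero_product US.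
by exists n, b.
Qed.
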